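(* Let $(X,d)$ be a complete metric space, $f:X\to\mathcal{I}$ be an interval-valued function with $f(x)=[\underline{f}(x),\overline{f}(x)]$, and $T:X\rightrightarrows X$ be a set-valued mapping. Suppose that (i) $f$ is $\preccurlyeq$-lower semicontinuous and $\preccurlyeq$-lower bounded; (ii) for any $x\in X$ and $y\in T(x)$, $f(y)+[d(x,y),d(x,y)]\preccurlyeq f(x)$. Then $T$ has a fixed point, i.e., there exists $\overline{x}\in X$ such that $\overline{x}\in T(\overline{x})$.
   Context: $\mathcal{I}=\{[a,b]:a\le b,\ a,b\in\mathbb{R}\}$ is the set of closed bounded real intervals, with addition $[\underline{a},\overline{a}]+[\underline{b},\overline{b}]=[\underline{a}+\underline{b},\overline{a}+\overline{b}]$. $[\underline{a},\overline{a}]\preccurlyeq[\underline{b},\overline{b}]$ means $\underline{a}\le\underline{b}$ and $\overline{a}\le\overline{b}$. An interval-valued function $f:X\to\mathcal{I}$ is written $f(x)=[\underline{f}(x),\overline{f}(x)]$ with $\underline f\le\overline f$ real-valued; it is $\preccurlyeq$-lower semicontinuous on $X$ if for every $A\in\mathcal{I}$ the set $\{x\in X:f(x)\preccurlyeq A\}$ is closed, and $\preccurlyeq$-lower bounded if there is $A\in\mathcal{I}$ with $A\preccurlyeq f(x)$ for all $x\in X$. A set-valued mapping $T:X\rightrightarrows X$ assigns to each $x\in X$ a subset $T(x)$ of $X$.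
   Formalization: The formal theorem assumes that X is nonempty and that T(x) is nonempty for every x in X; without this the claim is false, e.g. if X is one point, f is constant and T(x) is empty. *)

(* Defs.v *)
From HB Require Import structures.
From mathcomp Require Import all_boot all_order all_algebra.
From mathcomp Require Import all_classical all_reals all_analysis.

Set Implicit Arguments.
Unset Strict Implicit.
Unset Printing Implicit Defensive.

Import Order.TTheory GRing.Theory Num.Theory.

Local Open Scope classical_set_scope.
Local Open Scope ring_scope.

(* Complete includes a base point, so these spaces are nonempty. *)
#[short(type="completeMetricType")]
HB.structure Definition CompleteMetric (K : numDomainType) :=
  {M of Complete M & Metric K M}.

(* An interval is represented by its pair of endpoints: [a, b] with a <= b is
   nonempty, so as a subset of R it determines a and b. *)
Record cbitv (R : realType) := CBItv {
  ilow : R;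
  iupp : R;
  ilow_le_iupp : ilow <= iupp
}.

Definition cbitv_add (R : realType) (A B : cbitv R) : cbitv R :=
  CBItv (lerD (ilow_le_iupp A) (ilow_le_iupp B)).

Definition cbitv_point (R : realType) (r : R) : cbitv R := CBItv (lexx r).

Definition cbitv_le (R : realType) (A B : cbitv R) : Prop :=
  ilow A <= ilow B /\ iupp A <= iupp B.

Definition cbitv_lsc (R : realType) (X : topologicalType)
    (f : X -> cbitv R) : Prop :=
  forall A : cbitv R, closed [set x | cbitv_le (f x) A].

Definition cbitv_lower_bounded (R : realType) (X : Type)
    (f : X -> cbitv R) : Prop :=
  exists A : cbitv R, forall x, cbitv_le A (f x).

(* Main.v *)
Require Import Defs.
From mathcomp Require Import all_boot all_order all_algebra.
From mathcomp Require Import all_classical all_reals all_analysis.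
From mathcomp Require Import lra.

(** This is Caristi's fixed point theorem for the upper endpoint
    [g := iupp \o f] alone.  Since [ilow <= iupp], the interval [f x] lies below
    the degenerate interval [[c, c]] exactly when [g x <= c], so semicontinuity
    of [f] makes [g] lower semicontinuous.  (The lower endpoint can fail to be
    semicontinuous: where the upper endpoint is unbounded, the sublevel sets of
    [f] do not control it.)

    For a lower semicontinuous [g] bounded below, the relation
    [g y + d(x, y) <= g x] is a preorder whose upper sets are closed
    ([closed_caristi_le]); choosing a point that nearly minimises [g] on the
    upper set of [x] makes the upper set of that point as small as desired
    ([caristi_le_small]).  In a complete space these properties produce a point
    with no other point above it ([exists_maximal_closed_preorder]), by Cantor's
    intersection argument.  At such a point, each value of [T] lies
    above it in the preorder, hence equals it. *)

Import Order.TTheory GRing.Theory Num.Theory.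

Local Open Scope classical_set_scope.
Local Open Scope ring_scope.

(** Iterating the smallness hypothesis gives an increasing sequence whose upper
    sets shrink to a point; closedness puts the limit in all of them, so
    everything above the limit lies in their intersection. *)
Lemma exists_maximal_closed_preorder (R : realType) (X : completeMetricType R)
    (le : X -> X -> Prop)
    (le_refl : forall x, le x x)
    (le_trans : forall x y z, le x y -> le y z -> le x z)
    (le_closed : forall x, closed [set y | le x y])
    (le_small : forall x (e : R), 0 < e ->
       exists2 y, le x y & forall z, le y z -> mdist y z <= e) :
  exists x, forall y, le x y -> x = y.
Proof.
have step (p : nat * X) : {y | le p.2 y /\
    forall z, le y z -> mdist y z <= p.1.+1%:R^-1}.
  apply/cid; have [|y xy ysmall] := le_small p.2 p.1.+1%:R^-1.
    by rewrite invr_gt0 ltr0n.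
  by exists y.
pose u := nat_rect (fun=> X) point (fun n x => sval (step (n, x))).
have u_le n m : (n <= m)%N -> le (u n) (u m).
  elim: m => [|m IH]; first by rewrite leqn0 => /eqP ->.
  rewrite leq_eqVlt => /predU1P[->//|]; rewrite ltnS => /IH nm.
  exact: le_trans nm (svalP (step (m, u m))).1.
have u_small n z : le (u n.+1) z -> mdist (u n.+1) z <= n.+1%:R^-1.
  exact: (svalP (step (n, u n))).2.
have inv_lt (e : R) : 0 < e -> exists n : nat, n.+1%:R^-1 < e.
  move=> e0; have [N _ /(_ N (leqnn N)) Ne] := near_infty_natSinv_lt (PosNum e0).
  by exists N.
have /cauchy_cvg/cvg_ex[x ux] : cauchy (u @ \oo).
  apply: cauchy_exP => e /inv_lt[N Ne].
  exists (u N.+1); exists N.+1 => // m /= Nm; rewrite ballEmdist /=.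
  exact: le_lt_trans (u_small _ _ (u_le _ _ Nm)) Ne.
have le_x n : le (u n) x.
  apply: (closed_cvg _ (le_closed (u n)) _ _ ux).
  by exists n => // m /= nm; exact: u_le.
exists x => y xy; apply: mdist_positivity; apply/eqP.
rewrite eq_le mdist_ge0 andbT; apply/ler_addgt0Pl => e e0; rewrite addr0.
(* Both x and y lie within e / 2 of a common term of the sequence. *)
have [|n ne] := inv_lt (e / 2); first by rewrite divr_gt0.
move: (n.+1%:R^-1) (u_small n) ne => i u_small_n ie.
have := u_small_n x (le_x _); have := u_small_n y (le_trans _ _ _ (le_x _) xy).
by have := metric_triangle x (u n.+1) y; rewrite (metric_sym x (u n.+1)); lra.
Qed.

Definition caristi_le {R : realType} {X : metricType R} (g : X -> R) (x y : X) :=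
  g y + mdist x y <= g x.

Lemma caristi_le_refl (R : realType) (X : metricType R) (g : X -> R) x :
  caristi_le g x x.
Proof. by rewrite /caristi_le mdistxx addr0. Qed.

Lemma caristi_le_trans (R : realType) (X : metricType R) (g : X -> R) x y z :
  caristi_le g x y -> caristi_le g y z -> caristi_le g x z.
Proof. by rewrite /caristi_le; have := metric_triangle x y z; lra. Qed.

(** For [y] in the closure and [e > 0], points [z] of the upper set close to [y]
    satisfy [g z <= g x - d(x, y) + e], a closed condition on [z]. *)
Lemma closed_caristi_le (R : realType) (X : metricType R) (g : X -> R)
    (g_lsc : forall c : R, closed [set x | g x <= c]) x :
  closed [set y | caristi_le g x y].
Proof.
move=> y y_cl; rewrite /= /caristi_le; apply/ler_addgt0Pl => e e0.
suff : g y <= g x - mdist x y + e by lra.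
apply: (g_lsc (g x - mdist x y + e)) => U Uy.
have [z [/= xz [Uz]]] : [set z | caristi_le g x z] `&`
    (U `&` ball y e) !=set0.
  by apply: y_cl; apply: filterI => //; exact: (nbhsx_ballx y e e0).
rewrite ballEmdist /= => yz; exists z; split=> //=.
move: xz; rewrite /caristi_le.
by have := metric_triangle x z y; rewrite (metric_sym z y); lra.
Qed.

(** If [g y] is within [e] of the infimum of [g] over the upper set of [x], then
    a [z] above [y] is also above [x], so [d(y, z) <= g y - g z <= e]. *)
Lemma caristi_le_small (R : realType) (X : metricType R) (g : X -> R) (b : R)
    (g_ge : forall x, b <= g x) x (e : R) : 0 < e ->
  exists2 y, caristi_le g x y &
    forall z, caristi_le g y z -> mdist y z <= e.
Proof.
move=> e0; pose E := [set g y | y in [set y | caristi_le g x y]].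
have E_lb : has_lbound E by exists b => _ [y _ <-].
have E_inf : has_inf E.
  by split=> //; exists (g x); exists x => //; exact: caristi_le_refl.
have [_ [y xy <-] gy] := inf_adherent e0 E_inf.
exists y => // z yz.
have : inf E <= g z.
  by apply: ge_inf => //; exists z => //; exact: caristi_le_trans xy yz.
by move: yz gy; rewrite /caristi_le; lra.
Qed.

(** A degenerate interval [[c, c]] bounds [f x] from above as soon as it bounds
    its upper endpoint. *)
Lemma closed_iupp_sublevel (R : realType) (X : topologicalType)
    (f : X -> cbitv R) (c : R) :
  cbitv_lsc f -> closed [set x | iupp (f x) <= c].
Proof.
move=> /(_ (cbitv_point c)); congr closed.
apply/seteqP; split=> x /=; first by case.
by move=> fxc; split=> //; exact: le_trans (ilow_le_iupp (f x)) fxc.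
Qed.

Theorem theorem4p1 (R : realType) (X : completeMetricType R)
    (f : X -> cbitv R) (T : X -> set X)
    (T_nonempty : forall x : X, T x !=set0)
    (f_lsc : cbitv_lsc f) (f_bounded : cbitv_lower_bounded f)
    (f_decr : forall x y : X, T x y ->
       cbitv_le (cbitv_add (f y) (cbitv_point (mdist x y))) (f x)) :
  exists x : X, T x x.
Proof.
have [A A_le] := f_bounded.
have [x x_max] : exists x, forall y,
    caristi_le (fun x => iupp (f x)) x y -> x = y.
  apply: exists_maximal_closed_preorder.
  - exact: caristi_le_refl.
  - exact: caristi_le_trans.
  - by apply: closed_caristi_le => c; exact: closed_iupp_sublevel.
  - by apply: (caristi_le_small _ _ _ (iupp A)) => x; have [] := A_le x.
have [y Txy] := T_nonempty x; exists x.
by rewrite {2}(x_max y (f_decr x y Txy).2).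
Qed.
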